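(* Let $Y$ and $X$ be two Banach spaces and let $T: Y \longrightarrow X$ be a continuous linear operator. Then $T$ is a limited operator if and only if, for every convex continuous function $f: X \longrightarrow \mathbb{R}$ and every $y\in Y$, the function $f\circ T$ is Fréchet differentiable at $y\in Y$ whenever $f$ is Gâteaux differentiable at $T(y)\in X$.
   Context: Banach spaces are real. A subset $A$ of a Banach space $X$ is called limited if every weak$^*$ null sequence $(p_n)_n$ in $X^*$ converges to $0$ uniformly on $A$, that is, $\lim_{n\to+\infty}\sup_{x\in A}|\langle p_n,x\rangle|=0$. A bounded linear operator $T:Y\longrightarrow X$ is called limited if it maps the closed unit ball $B_Y$ of $Y$ to a limited subset of $X$; equivalently, the adjoint $T^*:X^*\longrightarrow Y^*$ maps weak$^*$ null sequences to norm null sequences. *)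

(* Defs.v *)
From HB Require Import structures.
From mathcomp Require Import all_boot all_order all_algebra.
From mathcomp Require Import all_classical all_reals all_analysis.

Set Implicit Arguments.
Unset Strict Implicit.
Unset Printing Implicit Defensive.

Import Order.TTheory GRing.Theory Num.Theory.
Import numFieldNormedType.Exports.

Local Open Scope classical_set_scope.
Local Open Scope ring_scope.

(** Elements of the topological dual are linear maps to the scalar field,
    viewed as the normed module [R^o], that are continuous. *)
Definition weak_star_null (R : realType) (X : normedModType R)
    (p : nat -> {linear X -> R^o}) : Prop :=
  (forall n, continuous (p n)) /\ (forall x : X, p n x @[n --> \oo] --> (0 : R^o)).

(** Uniform convergence is used instead of a limit of suprema so that the empty
    set is limited; [uniform_cvg0_supP] below shows that for nonempty sets the
    two formulations agree. *)
Definition limited_set (R : realType) (X : normedModType R) (A : set X) : Prop :=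
  forall p : nat -> {linear X -> R^o}, weak_star_null p ->
    {uniform A, ((fun n => p n : X -> R^o) @ \oo) --> (cst 0 : X -> R^o)}.

Definition limited_operator (R : realType) (Y X : normedModType R)
    (T : {linear Y -> X}) : Prop :=
  limited_set (T @` [set y : Y | `|y| <= 1]).

(** The Gateaux derivative is required to be linear and continuous. *)
Definition gateaux_differentiable (R : realType) (X : normedModType R)
    (f : X -> R^o) (x : X) : Prop :=
  exists2 p : {linear X -> R^o}, continuous p &
    forall h : X, is_derive x h f (p h).

Lemma uniform_cvg0_supP (R : realType) (X : normedModType R) (A : set X)
    (p : nat -> X -> R^o) : A !=set0 ->
  {uniform A, (p @ \oo) --> (cst 0 : X -> R^o)} <->
  (ereal_sup [set `|p n x|%:E | x in A] @[n --> \oo] --> (0 : \bar R)%E).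
Proof.
move=> [a Aa].
have sup_ge0 n : (0 <= ereal_sup [set `|p n x|%:E | x in A])%E.
  apply: (@le_trans _ _ `|p n a|%:E); first by rewrite lee_fin.
  by apply: ereal_sup_ubound; exists a.
split=> [pu|/fine_cvgP[supfin sup0]].
- have pe (e : R) : 0 < e ->
      \forall n \near \oo, (ereal_sup [set `|p n x|%:E | x in A] <= e%:E)%E.
    move=> e0.
    have : nbhs (cst 0 : {uniform` A -> R^o})
        [set h | forall y, A y -> ball (0 : R^o) e (h y)].
      apply/uniform_nbhs; exists [set xy | ball xy.1 e xy.2]; split => //.
      by rewrite -entourage_ballE; exists e.
    move=> /pu; rewrite /nbhs/=; apply: filterS => n pn.
    apply: ge_ereal_sup => _ [x Ax <-]; rewrite lee_fin.
    by have /ltW := pn _ Ax; rewrite sub0r normrN.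
  apply/fine_cvgP; split.
    near=> n; rewrite ge0_fin_numE//.
    by apply: (@le_lt_trans _ _ 1%:E); [near: n; exact: pe|exact: ltry].
  apply/cvgr0Pnorm_le => e e0; near=> n.
  have supe : (ereal_sup [set `|p n x|%:E | x in A] <= e%:E)%E.
    by near: n; exact: pe.
  have supfin : ereal_sup [set `|p n x|%:E | x in A] \is a fin_num.
    by rewrite ge0_fin_numE// (le_lt_trans supe)// ltry.
  by rewrite /= ger0_norm ?fine_ge0// -lee_fin fineK.
- move=> P /uniform_nbhs[E [entE EP]].
  have [e /= e0 eE] : exists2 e : R, 0 < e &
      [set xy : R^o * R^o | ball xy.1 e xy.2] `<=` E.
    by move: entE; rewrite -entourage_ballE => -[e e0 eE]; exists e.
  move/cvgr0Pnorm_lt : sup0 => /(_ e e0) sup0.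
  rewrite /nbhs/=; near=> n; apply: EP => y Ay; apply: eE => /=.
  have supn : ereal_sup [set `|p n x|%:E | x in A] \is a fin_num by near: n.
  have : `|fine (ereal_sup [set `|p n x|%:E | x in A])| < e by near: n.
  rewrite ger0_norm ?fine_ge0// => supe.
  rewrite /ball/= sub0r normrN (le_lt_trans _ supe)// -lee_fin fineK//.
  by apply: ereal_sup_ubound; exists y.
Unshelve. all: by end_near. Qed.

(* Main.v *)
Require Import Defs.
From HB Require Import structures.
From mathcomp Require Import all_boot all_order all_algebra.
From mathcomp Require Import all_classical all_reals all_analysis.
From mathcomp Require Import ring lra.

Import Order.TTheory GRing.Theory Num.Theory.
Import numFieldNormedType.Exports.

Local Open Scope classical_set_scope.
Local Open Scope ring_scope.

Set Implicit Arguments.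
Unset Strict Implicit.
Unset Printing Implicit Defensive.

(** Suppose first that [T] is limited, and let [f] be convex, continuous and
    Gateaux differentiable at [T y] with derivative [p]. If [f \o T] were not
    Frechet differentiable at [y], there would be [e > 0] and [h_n --> 0] with
    [f (T y + T h_n) - f (T y) - p (T h_n) > e * `|h_n|]. A subgradient [q_n] of
    [f] at [T y + T h_n] then satisfies [(q_n - p) (T h_n) > e * `|h_n|]. Because
    [f] is continuous and has derivative [p] at [T y], the functionals [q_n - p]
    converge pointwise to zero ([subgradient_cvg]), so they are weak* null; this
    contradicts the limitedness of [T], tested at [h_n / `|h_n|].

    Subgradients come from a Hahn-Banach argument for convex functions: by Zorn's
    lemma, a convex [F] with [F 0 = 0] has a minimal convex minorant vanishing at
    [0], and minimality forces it to be linear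
    ([minimal_convex_minorant_line], [linear_minorant]).

    Conversely, given a weak* null sequence [p], consider
    [f x = sup_n max (0, `|p_n x| - (n + 1)^-1)]. It is convex, it is Lipschitz by
    the uniform boundedness principle, and it is Gateaux differentiable at [0]
    with zero derivative: along a fixed direction only finitely many [p_n] are
    not small, and these are killed near [0] by the subtracted constants. If
    [f \o T] is Frechet differentiable at [0], then [f (T y) <= (e / 2) * `|y|] on
    some ball of radius [d], so [`|p_n (T y)| <= e / 2 + (n + 1)^-1 * 2 / d] on the
    unit ball, and [p_n \o T] converges to zero uniformly there
    ([truncated_sup_uniform]). *)

(** * Convex functions and their convex minorants *)

(** Convexity of a real function on the whole space, with two weights of sum one
    in place of a weight bundled with its bounds. *)
Definition convexf {R : realType} {X : lmodType R} (f : X -> R) : Prop :=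
  forall (a b : R) (x y : X), 0 <= a -> 0 <= b -> a + b = 1 ->
    f (a *: x + b *: y) <= a * f x + b * f y.

Lemma convex_functionP (R : realType) (X : lmodType R) (f : X -> R) :
  convex_function [set: convex_lmodType X] (f : X -> R^o) <-> convexf f.
Proof.
split=> [cf a b x y a0 b0 ab|cf t x y _ _].
  have a1 : a <= 1 by lra.
  have := cf (Itv01 a0 a1) x y (in_setT _) (in_setT _).
  have b1a : b = 1 - a by rewrite -ab addrC addKr.
  by rewrite b1a; exact.
have t1 : 0 <= 1 - t%:num :> R by rewrite subr_ge0.
apply: (cf t%:num (1 - t%:num) x y _ t1); first exact: ge0.
by rewrite addrC subrK.
Qed.

Lemma convex_midpoint (R : realType) (X : lmodType R) (g : X -> R) (x y : X) :
  convexf g -> 2 * g (2^-1 *: (x + y)) <= g x + g y.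
Proof.
move=> cg.
have := cg 2^-1 2^-1 x y ltac:(lra) ltac:(lra) ltac:(lra).
by rewrite -scalerDr; lra.
Qed.

(** The convex functions below [F] that vanish at the origin. *)
Definition convex_minorant {R : realType} {X : lmodType R} (F g : X -> R) : Prop :=
  [/\ convexf g, g 0 = 0 & forall x, g x <= F x].

(** This lower bound does not depend on the minorant, so the infimum of any
    nonempty family of convex minorants is finite. *)
Lemma convex_minorant_ge (R : realType) (X : lmodType R) (F g : X -> R) (x : X) :
  convex_minorant F g -> - F (- x) <= g x.
Proof.
move=> [cg g0 gF]; have := @convex_midpoint _ _ g x (- x) cg.
rewrite subrr scaler0 g0; have := gF (- x); lra.
Qed.

(** The last hypothesis is a directed form of joint convexity in the index and the
    point. It holds for a chain of convex functions, with [k] the index of the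
    smaller of the two, and for a family jointly convex in [x] and a real
    parameter. *)
Lemma convex_minorant_inf (R : realType) (X : lmodType R) (F : X -> R)
    (I : Type) (D : set I) (K : I -> X -> R) (i0 : I) :
  F 0 = 0 -> D i0 -> (forall x, K i0 x <= F x) ->
  (forall i x, D i -> - F (- x) <= K i x) ->
  (forall i j x y a b, D i -> D j -> 0 <= a -> 0 <= b -> a + b = 1 ->
    exists2 k, D k & K k (a *: x + b *: y) <= a * K i x + b * K j y) ->
  let k := fun x => inf [set K i x | i in D] in
  convex_minorant F k /\ forall i x, D i -> k x <= K i x.
Proof.
move=> F0 Di0 KF FK dir k.
have lbK x : has_inf [set K i x | i in D].
  split; first by exists (K i0 x), i0.
  by exists (- F (- x)) => _ [i Di <-]; exact: FK.
have kK i x : D i -> k x <= K i x.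
  by move=> Di; apply: ge_inf; [case: (lbK x)|exists i].
split=> //; split.
- move=> a b x y a0 b0 ab; apply/ler_addgt0Pr => e e0.
  have [_ [i Di <-] Ki] := inf_adherent e0 (lbK x).
  have [_ [j Dj <-] Kj] := inf_adherent e0 (lbK y).
  have [l Dl Kl] := dir i j x y a b Di Dj a0 b0 ab.
  apply: (le_trans (kK _ _ Dl)); apply: (le_trans Kl).
  rewrite -/(k x) in Ki; rewrite -/(k y) in Kj.
  have -> : a * k x + b * k y + e = a * (k x + e) + b * (k y + e).
    by rewrite -[in LHS](mul1r e) -ab; ring.
  by rewrite lerD// ler_wpM2l// ltW.
- apply/eqP; rewrite eq_le; apply/andP; split.
    by apply: (le_trans (kK _ _ Di0)); rewrite -F0.
  have -> : 0 = - F (- 0 : X) by rewrite oppr0 F0 oppr0.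
  apply: lb_le_inf; first by exists (K i0 0), i0.
  by move=> _ [i Di <-]; exact: FK.
- by move=> x; exact: le_trans (kK _ _ Di0) (KF x).
Qed.

(** * Hahn-Banach for convex functions *)

Lemma exists_minimal_convex_minorant (R : realType) (X : lmodType R) (F : X -> R) :
  convexf F -> F 0 = 0 ->
  exists2 g, convex_minorant F g &
    forall k, convex_minorant F k -> (forall x, k x <= g x) -> k = g.
Proof.
move=> cF F0.
(* The order is reversed: [below g k] says that [k] is the smaller function, so
   that a maximal element is a minimal minorant. *)
pose below (g k : {g : X -> R | convex_minorant F g}) :=
  `[< forall x, sval k x <= sval g x >].
have [| | | |[g Fg] gmin] := @Zorn _ below.
- by move=> g; apply/asboolP.
- move=> g k l /asboolP gk /asboolP kl; apply/asboolP => x.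
  exact: le_trans (kl x) (gk x).
- move=> [g Fg] [k Fk] /asboolP /= gk /asboolP /= kg.
  by apply/eq_exist/funext => x; apply/le_anti; rewrite gk kg.
- move=> A Atot; have [[g0 Ag0]|A0] := pselect (A !=set0); last first.
    have FF : convex_minorant F F by split.
    by exists (exist _ F FF) => s As; case: A0; exists s.
  have [||||Fk kA] := @convex_minorant_inf R X F _ A (fun g => sval g) g0 F0.
  + exact: Ag0.
  + by case: g0 {Ag0} => g [].
  + by move=> [g Fg] x _; exact: convex_minorant_ge.
  + move=> g k x y a b Ag Ak a0 b0 ab.
    have [/asboolP gk|/asboolP kg] := Atot _ _ Ag Ak.
      exists k => //; case: k gk {Ak} => k [ck k0 kF] /= gk.
      by apply: (le_trans (ck _ _ _ _ a0 b0 ab)); rewrite lerD2r ler_wpM2l.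
    exists g => //; case: g kg {Ag} => g [cg g00 gF] /= kg.
    by apply: (le_trans (cg _ _ _ _ a0 b0 ab)); rewrite lerD2l ler_wpM2l.
  + exists (exist _ _ Fk) => s As; apply/asboolP => x /=; exact: kA.
exists g => // k Fk kg.
by have /(congr1 sval) := gmin (exist _ k Fk) (asboolT kg).
Qed.

(** Hahn-Banach on a line: the slope [c] is the right derivative at [0] of
    [t |-> g (t *: y)]. *)
Lemma convex_line_support (R : realType) (X : lmodType R) (g : X -> R) (y : X) :
  convexf g -> g 0 = 0 -> exists c, forall t, t * c <= g (t *: y).
Proof.
move=> cg g0.
pose S := [set g (t *: y) / t | t in [set t | 0 < t]].
(* The negative slopes bound the positive ones from below, since [0] is a convex
   combination of [- s *: y] and [t *: y]. *)
have Slb s r : 0 < s -> S r -> - (g (- s *: y) / s) <= r.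
  move=> s0 [t /= t0 <-].
  have st : 0 < s + t by exact: addr_gt0.
  have ge0 r' : 0 < r' -> 0 <= r' / (s + t) by move=> ?; rewrite ltW// divr_gt0.
  have := cg (t / (s + t)) (s / (s + t)) (- s *: y) (t *: y) (ge0 t t0) (ge0 s s0).
  rewrite !scalerA.
  have -> : t / (s + t) * - s = - (s / (s + t) * t) by ring.
  rewrite scaleNr addNr g0 -mulrDl (addrC t) divff ?gt_eqF// => /(_ erefl).
  have -> : t / (s + t) * g (- s *: y) + s / (s + t) * g (t *: y) =
      (s * t / (s + t)) * (g (- s *: y) / s + g (t *: y) / t).
    by field; rewrite !gt_eqF.
  rewrite pmulr_rge0; last by rewrite divr_gt0// mulr_gt0.
  by rewrite -lerBlDl sub0r.
have S0 : S !=set0 by exists (g (1 *: y) / 1), 1 => //=.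
have infS : has_inf S by split=> //; exists (- (g (- 1 *: y) / 1)) => r; exact: Slb.
exists (inf S) => t; have [t0|t0|->] := ltgtP t 0.
- have := lb_le_inf S0 (fun r => @Slb (- t) r ltac:(by rewrite oppr_gt0)).
  by rewrite opprK invrN mulrN opprK ler_ndivrMr// mulrC.
- by rewrite mulrC -ler_pdivlMr//; apply: ge_inf; [case: infS|exists t].
- by rewrite mul0r scale0r g0.
Qed.

(** With [c] supporting [g] on the line through [y], the marginal
    [inf_t (g (x + t *: y) - t * c)] is again a convex minorant and lies below
    [g], so by minimality it equals [g]. *)
Lemma minimal_convex_minorant_line (R : realType) (X : lmodType R) (F g : X -> R) :
  F 0 = 0 -> convex_minorant F g ->
  (forall k, convex_minorant F k -> (forall x, k x <= g x) -> k = g) ->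
  forall y, exists c, forall x t, g (x + t *: y) = g x + t * c.
Proof.
move=> F0 Fg gmin y; have [cg g0 gF] := Fg.
have [c cP] := @convex_line_support _ _ g y cg g0.
exists c.
have le x t : g x <= g (x + t *: y) - t * c.
  have [||||Fk kK] := @convex_minorant_inf R X F R setT
    (fun t x => g (x + t *: y) - t * c) 0 F0 => //.
  - by move=> z; rewrite scale0r addr0 mul0r subr0.
  (* [z + s *: y] and [- z] have midpoint [(s / 2) *: y], where the support [c]
     applies. *)
  - move=> s z _.
    have := @convex_midpoint _ _ g (z + s *: y) (- z) cg.
    rewrite addrC addKr scalerA.
    have := cP (2^-1 * s); have := gF (- z); lra.
  - move=> s r z w a b _ _ a0 b0 ab; exists (a * s + b * r) => //.
    have -> : a *: z + b *: w + (a * s + b * r) *: y =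
        a *: (z + s *: y) + b *: (w + r *: y).
      by rewrite scalerDl !scalerDr !scalerA addrACA.
    have := cg a b (z + s *: y) (w + r *: y) a0 b0 ab; lra.
  rewrite -[leLHS](congr1 (fun h => h x) (gmin _ Fk _)) /=; first exact: kK.
  by move=> z; apply: (le_trans (kK 0 z Logic.I)); rewrite scale0r addr0 mul0r subr0.
(* The inequality at [x + t *: y] with parameter [- t] is the converse of the one at [x]. *)
move=> x t; apply/le_anti/andP; split; last by have := le x t; lra.
have := le (x + t *: y) (- t); rewrite scaleNr addrK; lra.
Qed.

Lemma linear_minorant (R : realType) (X : lmodType R) (F : X -> R) :
  convexf F -> F 0 = 0 -> exists q : {linear X -> R^o}, forall h, q h <= F h.
Proof.
move=> cF F0.
have [g Fg gmin] := @exists_minimal_convex_minorant _ _ F cF F0.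
have gline := @minimal_convex_minorant_line _ _ F g F0 Fg gmin.
have [cg g0 gF] := Fg.
have glin : linear (g : X -> R^o).
  move=> a x y; have [c cP] := gline x.
  have gx : g x = c.
    by have := cP 0 1; rewrite add0r scale1r g0 add0r mul1r.
  by have := cP y a; rewrite (addrC y) -gx => ->; exact: addrC.
pose q : {linear X -> R^o} := HB.pack (g : X -> R^o)
  (GRing.isLinear.Build _ _ _ _ (g : X -> R^o) glin).
by exists q.
Qed.

(** A linear functional bounded above near the origin is bounded near the origin. *)
Lemma continuous_linear_minorant (R : realType) (X : normedModType R)
    (F : X -> R^o) :
  convexf F -> F 0 = 0 -> {for 0, continuous F} ->
  exists2 q : {linear X -> R^o}, continuous q & forall h, q h <= F h.
Proof.
move=> cF F0 ctF; have [q qF] := @linear_minorant _ _ F cF F0.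
exists q => //; apply/linear_bounded_continuous/ex_bound; exists 1.
have F1 : \forall x \near (0 : X), F x <= 1.
  move/cvgrPdist_le : ctF => /(_ 1 ltr01); apply: filterS => x.
  by rewrite F0 sub0r normrN; exact: le_trans (ler_norm _).
have F1N : \forall x \near (0 : X), F (- x) <= 1.
  by have := @opp_continuous X 0; rewrite /continuous_at oppr0 => /(_ _ F1).
near=> x; rewrite /= ler_norml; apply/andP; split.
  rewrite lerNl -linearN; apply: le_trans (qF _) _; near: x; exact: F1N.
by apply: le_trans (qF _) _; near: x; exact: F1.
Unshelve. all: by end_near. Qed.

Lemma exists_subgradient (R : realType) (X : normedModType R) (f : X -> R^o)
    (x : X) : convexf f -> continuous f ->
  exists2 q : {linear X -> R^o}, continuous q & forall k, q k <= f (x + k) - f x.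
Proof.
move=> cf ctf; apply: (@continuous_linear_minorant _ _ (fun k => f (x + k) - f x)).
- move=> a b k l a0 b0 ab.
  have := cf a b (x + k) (x + l) a0 b0 ab.
  have -> : a *: (x + k) + b *: (x + l) = x + (a *: k + b *: l).
    by rewrite !scalerDr addrACA -scalerDl ab scale1r.
  have fx : f x = a * f x + b * f x by rewrite -mulrDl ab mul1r.
  lra.
- by rewrite addr0 subrr.
- apply: (@continuousB _ _ _ (fun k => f (x + k)) (cst (f x)) 0).
    apply: (@continuous_comp _ _ _ (fun k => x + k) f); last exact: ctf.
    by apply: (@continuousD _ _ _ (cst x) id); [exact: cvg_cst|exact: cvg_id].
  exact: cvg_cst.
Qed.

(** * Derivatives of convex functions *)

Lemma is_derive_quotientP (R : realType) (X : normedModType R) (f : X -> R^o)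
    (x h : X) (d : R^o) :
  is_derive x h f d <->
  forall e : R, 0 < e ->
    \forall t \near (0 : R)^', `|d - t^-1 * (f (t *: h + x) - f x)| <= e.
Proof.
split=> [[fxh <-]|H].
  by move/cvgrPdist_le : fxh; exact.
have fd : t^-1 *: ((f \o shift x) (t *: h) - f x) @[t --> 0^'] --> d.
  exact/cvgrPdist_le.
split; [exact: cvgP fd|exact: cvg_lim fd].
Qed.

Lemma exists_small_quotient (R : realType) (X : normedModType R) (f : X -> R^o)
    (x h : X) (d : R^o) (e : R) : is_derive x h f d -> 0 < e ->
  exists t, [/\ 0 < t, t < 1 & `|d - t^-1 * (f (t *: h + x) - f x)| <= e].
Proof.
move=> /is_derive_quotientP/[apply].
rewrite near_withinE => /nbhs_norm0P[r /= r0 rP].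
have m0 : 0 < Num.min r 1 by rewrite lt_min r0 ltr01.
exists (Num.min r 1 / 2); split; first by rewrite divr_gt0.
- have : Num.min r 1 <= 1 by rewrite ge_min lexx orbT.
  lra.
- apply: rP; last by rewrite gt_eqF// divr_gt0.
  rewrite /= ger0_norm ?divr_ge0 ?(ltW m0)//.
  have : Num.min r 1 <= r by rewrite ge_min lexx.
  lra.
Qed.

Lemma convex_derive_le (R : realType) (X : normedModType R) (f : X -> R^o)
    (x h : X) (d : R^o) :
  convexf f -> is_derive x h f d -> d <= f (x + h) - f x.
Proof.
move=> cf fd; apply/ler_addgt0Pr => e e0.
have [t [t0 t1 te]] := exists_small_quotient fd e0.
have : t^-1 * (f (t *: h + x) - f x) <= f (x + h) - f x.
  rewrite ler_pdivrMl//.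
  have := cf t (1 - t) (x + h) x (ltW t0) ltac:(by rewrite subr_ge0 ltW)
    ltac:(by rewrite addrC subrK).
  have -> : t *: (x + h) + (1 - t) *: x = t *: h + x.
    by rewrite scalerDr scalerBl scale1r addrC addrA subrK addrC.
  lra.
have := ler_norm (d - t^-1 * (f (t *: h + x) - f x)); lra.
Qed.

(** Frechet differentiability from a candidate derivative and its error estimate. *)
Lemma differentiable_eps (R : realType) (Y : normedModType R) (f : Y -> R^o)
    (y : Y) (p : {linear Y -> R^o}) : continuous p ->
  (forall e : R, 0 < e ->
    \forall h \near (0 : Y), `|f (h + y) - f y - p h| <= e * `|h|) ->
  differentiable f y.
Proof.
move=> cp H.
have fp : f \o shift y = cst (f y) + p +o_ (0 : Y) id.
  apply/eqaddoP => e e0; apply: filterS (H _ e0) => h.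
  by rewrite !fctE /= opprD addrA.
have dp := diff_unique cp fp.
by apply/diff_locallyP; rewrite dp.
Qed.

Lemma differentiable_norm_le (R : realType) (Y : normedModType R) (f : Y -> R^o)
    (y : Y) (e : R) : differentiable f y -> 0 < e ->
  \forall h \near (0 : Y), `|f (h + y) - f y - 'd f y h| <= e * `|h|.
Proof.
move=> /diff_locallyP[_ /eqaddoP H] /H; apply: filterS => h.
by rewrite !fctE /= opprD addrA.
Qed.

(** Subgradients at points tending to [x] converge pointwise to the Gateaux
    derivative at [x]. For small [t > 0], [q n h] is at most the difference quotient
    of [f] at [x + z n] with step [t], which tends to the one at [x]; applying
    this to [- h] gives the lower bound. *)
Lemma subgradient_cvg (R : realType) (X : normedModType R) (f : X -> R^o)
    (x : X) (p : {linear X -> R^o}) (z : nat -> X) (q : nat -> {linear X -> R^o}) :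
  continuous f -> (forall h, is_derive x h f (p h)) -> z @ \oo --> (0 : X) ->
  (forall n h, q n h <= f (x + z n + h) - f (x + z n)) ->
  forall h, q n h - p h @[n --> \oo] --> (0 : R^o).
Proof.
move=> cf fp z0 qf.
have upper h e : 0 < e -> \forall n \near \oo, q n h - p h <= e.
  move=> e0; have e20 : 0 < e / 2 by rewrite divr_gt0.
  have [t [t0 t1 te]] := exists_small_quotient (fp h) e20.
  have {}te : f (t *: h + x) - f x <= t * (p h + e / 2).
    rewrite -ler_pdivrMl//; move: te; rewrite distrC => /(le_trans (ler_norm _)).
    by rewrite lerBlDl.
  have xz : x + z n @[n --> \oo] --> x.
    by rewrite -[X in _ --> X]addr0; apply: cvgD => //; exact: cvg_cst.
  have xzh : x + z n + t *: h @[n --> \oo] --> x + t *: h.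
    by apply: cvgD => //; exact: cvg_cst.
  have fz : f (x + z n + t *: h) - f (x + z n) @[n --> \oo] -->
      f (x + t *: h) - f x.
    by apply: cvgB; [exact: (cvg_comp _ _ xzh (cf _))|exact: (cvg_comp _ _ xz (cf _))].
  have te0 : 0 < t * (e / 2) by rewrite mulr_gt0.
  move/cvgrPdist_le : fz => /(_ _ te0); apply: filterS => n.
  rewrite distrC => /(le_trans (ler_norm _)) fn.
  have qt : q n (t *: h) = t * q n h :> R by rewrite linearZ.
  have := qf n (t *: h); rewrite qt => {}qt.
  rewrite [x + t *: h]addrC in fn.
  have : t * (q n h - p h) <= t * e by lra.
  by rewrite ler_pM2l.
move=> h; apply/cvgr0Pnorm_le => e e0; near=> n.
rewrite ler_norml; apply/andP; split; last by near: n; exact: upper.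
have : q n (- h) - p (- h) <= e by near: n; exact: upper.
have -> : q n (- h) = - q n h :> R by rewrite linearN.
have -> : p (- h) = - p h :> R by rewrite linearN.
lra.
Unshelve. all: by end_near. Qed.

(** * Limited operators *)

Lemma uniform_cvg0P (R : realType) (X : normedModType R) (A : set X)
    (p : nat -> X -> R^o) :
  {uniform A, (p @ \oo) --> (cst 0 : X -> R^o)} <->
  forall e : R, 0 < e -> \forall n \near \oo, forall x, A x -> `|p n x| <= e.
Proof.
split=> [pu e e0|H P /uniform_nbhs[E [entE EP]]].
- have : nbhs (cst 0 : {uniform` A -> R^o})
      [set h | forall y, A y -> ball (0 : R^o) e (h y)].
    apply/uniform_nbhs; exists [set xy | ball xy.1 e xy.2]; split => //.
    by rewrite -entourage_ballE; exists e.
  move=> /pu; rewrite /nbhs/=; apply: filterS => n pn x Ax.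
  by have /ltW := pn _ Ax; rewrite sub0r normrN.
- have [e /= e0 eE] : exists2 e : R, 0 < e &
      [set xy : R^o * R^o | ball xy.1 e xy.2] `<=` E.
    by move: entE; rewrite -entourage_ballE => -[e e0 eE]; exists e.
  have e20 : 0 < e / 2 by rewrite divr_gt0.
  rewrite /nbhs/=; apply: filterS (H _ e20) => n pn.
  apply: EP => y Ay; apply: eE => /=.
  rewrite /ball/= sub0r normrN; have := pn _ Ay; lra.
Qed.

Lemma limited_operatorP (R : realType) (Y X : normedModType R)
    (T : {linear Y -> X}) :
  limited_operator T <-> forall p : nat -> {linear X -> R^o}, weak_star_null p ->
    forall e : R, 0 < e ->
      \forall n \near \oo, forall y : Y, `|y| <= 1 -> `|p n (T y)| <= e.
Proof.
split=> [LT p p0 e e0|H p p0].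
  have /uniform_cvg0P/(_ e e0) := LT p p0.
  by apply: filterS => n pn y y1; apply: pn; exists y.
apply/uniform_cvg0P => e e0; apply: filterS (H p p0 e e0) => n pn _ [y y1 <-].
exact: pn.
Qed.

Lemma limited_frechet (R : realType) (Y X : normedModType R)
    (T : {linear Y -> X}) (f : X -> R^o) (y : Y) :
  continuous T -> limited_operator T -> convexf f -> continuous f ->
  gateaux_differentiable f (T y) -> differentiable (f \o T) y.
Proof.
move=> cT /limited_operatorP LT cf ctf [p cp fp].
apply: (@differentiable_eps _ _ _ _ (p \o T)).
  by move=> h; apply: continuous_comp; [exact: cT|exact: cp].
move=> e e0; apply: contrapT => nH.
have /choice[h hP] : forall n, exists h : Y, `|h| < n.+1%:R^-1 /\
    e * `|h| < f (T y + T h) - f (T y) - p (T h).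
  move=> n; apply: contrapT => nh; apply: nH; apply/nbhs_norm0P.
  exists n.+1%:R^-1 => /=; first by rewrite invr_gt0.
  move=> h /= hn; rewrite leNgt; apply/negP => eh; apply: nh; exists h; split=> //.
  move: eh; rewrite /= linearD [T h + _]addrC ger0_norm//.
  by rewrite subr_ge0; apply: convex_derive_le.
have h0 : h @ \oo --> (0 : Y).
  apply/cvgr0Pnorm_le => r r0; near=> n.
  apply: ltW; apply: (lt_trans (hP n).1); near: n.
  exact: (near_infty_natSinv_lt (PosNum r0)).
have Th0 : T \o h @ \oo --> (0 : X).
  by rewrite -(linear0 T); apply: (cvg_comp _ _ h0); exact: cT.
have /choice[q qP] : forall n, exists q : {linear X -> R^o}, continuous q /\
    forall k, q k <= f (T y + T (h n) + k) - f (T y + T (h n)).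
  by move=> n; have [q cq qf] := exists_subgradient (T y + T (h n)) cf ctf; exists q.
have w0 : weak_star_null (fun n => q n \- p : {linear X -> R^o}).
  split=> [n x|x].
    by apply: continuousB; [exact: (qP n).1|exact: cp].
  apply: (@subgradient_cvg _ _ f (T y) p (T \o h)) => // n; exact: (qP n).2.
have [n Hn] : exists n, forall z : Y, `|z| <= 1 -> `|q n (T z) - p (T z)| <= e.
  by have [n _ Hn] := LT _ w0 _ e0; exists n => z; apply: (Hn n) => /=.
have [_ hn] := hP n; have [_ qn] := qP n.
have hn0 : 0 < `|h n|.
  rewrite normr_gt0; apply: contraTneq hn => ->.
  by rewrite !linear0 normr0 mulr0 !addr0 subrr ltxx.
(* Testing at the unit vector along [h n] contradicts [hn], through the subgradient
   inequality at the increment [- T (h n)]. *)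
have := Hn (`|h n|^-1 *: h n).
rewrite normrZ normfV normr_id mulVf ?gt_eqF// lexx => /(_ isT).
have lin (r : {linear X -> R^o}) :
  r (T (`|h n|^-1 *: h n)) = `|h n|^-1 * r (T (h n)) :> R by rewrite !linearZ.
rewrite !lin -mulrBr => /(le_trans (ler_norm _)).
rewrite ler_pdivrMl// mulrC.
have := qn (- T (h n)); rewrite addrK.
have -> : q n (- T (h n)) = - q n (T (h n)) :> R by rewrite linearN.
lra.
Unshelve. all: by end_near. Qed.

(** * The truncated supremum of a weak* null sequence *)

(** The uniform boundedness principle; this is where completeness is needed. *)
Lemma weak_star_null_bounded (R : realType) (X : completeNormedModType R)
    (p : nat -> {linear X -> R^o}) : weak_star_null p ->
  exists2 M, 0 <= M & forall n x, `|p n x| <= M * `|x|.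
Proof.
move=> [cp p0].
have [||M MP] := @Banach_Steinhauss R X R^o (range (fun n => p n : X -> R^o)) _ _ 1.
- move=> _ [n _ <-]; split; last by move=> a x y; exact: linearP.
  exact/bounded_funP/linear_bounded_continuous/cp.
- move=> x; have bx : bounded_fun (fun n => p n x) := cvg_seq_bounded (cvgP _ (p0 x)).
  have [M _ MP] := pinfty_ex_gt0 bx.
  by exists M => _ [n _ <-]; exact: MP.
exists M.
  have := MP (p 0%N) (ex_intro2 _ _ 0%N Logic.I erefl) 0.
  by rewrite normr0 => /(_ ler01); exact: le_trans.
move=> n x; have [->|x0] := eqVneq x 0; first by rewrite linear0 !normr0 mulr0.
have := MP (p n) (ex_intro2 _ _ n Logic.I erefl) (`|x|^-1 *: x).
rewrite normrZ normfV normr_id mulVf ?normr_eq0// lexx => /(_ isT).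
by rewrite linearZ normrZ normfV normr_id ler_pdivrMl ?normr_gt0// mulrC.
Qed.

(** The supremum over [n] of the positive parts of [`|p n x| - n.+1%:R^-1]. The
    value [0] is put in the set instead of taking positive parts. The supremum is
    meaningful when [p] is pointwise bounded. *)
Definition truncated_sup {R : realType} {X : normedModType R}
    (p : nat -> {linear X -> R^o}) (x : X) : R :=
  sup [set r | r = 0 \/ exists n, r = `|p n x| - n.+1%:R^-1].

Section truncated_sup.
Variables (R : realType) (X : completeNormedModType R).
Variable p : nat -> {linear X -> R^o}.
Hypothesis p0 : weak_star_null p.
Local Notation f := (truncated_sup p).

Let has_sup_truncated x :
  has_sup [set r : R | r = 0 \/ exists n, r = `|p n x| - n.+1%:R^-1].
Proof.
have [M M0 MP] := weak_star_null_bounded p0.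
split; first by exists 0; left.
exists (M * `|x|) => _ [->|[n ->]]; first by rewrite mulr_ge0.
by rewrite (le_trans _ (MP n x))// gerBl.
Qed.

Lemma truncated_sup_ge0 x : 0 <= f x.
Proof. by apply: (ub_le_sup (has_sup_truncated x).2); left. Qed.

Lemma truncated_sup_ge x n : `|p n x| - n.+1%:R^-1 <= f x.
Proof. by apply: (ub_le_sup (has_sup_truncated x).2); right; exists n. Qed.

Lemma truncated_sup_le x (c : R) :
  0 <= c -> (forall n, `|p n x| <= c + n.+1%:R^-1) -> f x <= c.
Proof.
move=> c0 H; apply: (ge_sup (has_sup_truncated x).1) => _ [->//|[n ->]].
by rewrite lerBlDr.
Qed.

Lemma truncated_sup0 : f 0 = 0.
Proof.
apply/le_anti; rewrite truncated_sup_ge0 andbT.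
by apply: truncated_sup_le => // n; rewrite linear0 normr0 add0r invr_ge0.
Qed.

Lemma truncated_supN x : f (- x) = f x.
Proof.
rewrite /truncated_sup; congr sup; apply/seteqP.
by split=> r [->|[n ->]]; [left|right; exists n|left|right; exists n];
  rewrite // linearN normrN.
Qed.

Lemma truncated_sup_convex : convexf f.
Proof.
move=> a b x y a0 b0 ab; apply: truncated_sup_le => [|n].
  by rewrite addr_ge0// mulr_ge0// truncated_sup_ge0.
have := ler_normD (a * p n x) (b * p n y).
have <- : p n (a *: x + b *: y) = a * p n x + b * p n y :> R.
  by rewrite linearD !linearZ.
rewrite !normrM (ger0_norm a0) (ger0_norm b0) => /le_trans; apply.
have -> : n.+1%:R^-1 = a * n.+1%:R^-1 + b * n.+1%:R^-1 :> R.
  by rewrite -mulrDl ab mul1r.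
rewrite addrACA -!mulrDr lerD// ler_wpM2l// -lerBlDr; exact: truncated_sup_ge.
Qed.

Lemma truncated_sup_continuous : continuous (f : X -> R^o).
Proof.
have [M M0 MP] := weak_star_null_bounded p0.
have lip x y : f x <= f y + M * `|x - y|.
  apply: truncated_sup_le => [|n].
    by rewrite addr_ge0 ?mulr_ge0// truncated_sup_ge0.
  apply: (@le_trans _ _ (`|p n y| + `|p n (x - y)|)).
    by rewrite -[in leLHS](subrK y x) addrC linearD ler_normD.
  by rewrite addrAC lerD// -lerBlDr; exact: truncated_sup_ge.
have M10 : 0 < M + 1 by rewrite ltr_wpDl.
move=> x; apply/cvgrPdist_le => e e0; near=> y.
have Mxy : M * `|x - y| <= e.
  have : `|x - y| <= e / (M + 1).
    near: y; apply/nbhs_normP; exists (e / (M + 1)); first by rewrite /= divr_gt0.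
    by move=> y /ltW.
  rewrite ler_pdivlMr// mulrC; apply: le_trans.
  by rewrite ler_wpM2r// lerDl.
have := lip x y; have := lip y x; rewrite distrC => *.
by rewrite ler_norml; apply/andP; split; lra.
Unshelve. all: by end_near. Qed.

(** The indices from some [N] on satisfy [`|p n h| <= e]; the finitely many others
    contribute nothing once [`|p n (t *: h)|] is at most [N.+1%:R^-1]. *)
Lemma truncated_sup_small h (e : R) : 0 < e ->
  \forall t \near (0 : R), f (t *: h) <= e * `|t|.
Proof.
move=> e0; have [_ /(_ h)/cvgr0Pnorm_le/(_ _ e0)[N _ pN]] := p0.
have [M M0 MP] := weak_star_null_bounded p0.
have Mh : 0 < M * `|h| + 1 by rewrite ltr_wpDl// mulr_ge0.
have tsmall : \forall t \near (0 : R), `|t| <= N.+1%:R^-1 / (M * `|h| + 1).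
  apply/nbhs_norm0P; exists (N.+1%:R^-1 / (M * `|h| + 1)).
    by rewrite /= divr_gt0.
  by move=> t /ltW.
near=> t; apply: truncated_sup_le => [|n]; first by rewrite mulr_ge0// ltW.
have -> : p n (t *: h) = t * p n h :> R by rewrite linearZ.
rewrite normrM; have [Nn|nN] := leqP N n.
  by rewrite mulrC ler_wpDr// ler_wpM2r//; exact: pN.
apply: ler_wpDl; first by rewrite mulr_ge0// ltW.
apply: (@le_trans _ _ N.+1%:R^-1); last by rewrite lef_pV2 ?posrE// ler_nat ltnS ltnW.
apply: (@le_trans _ _ (`|t| * (M * `|h|))); first by rewrite ler_wpM2l.
have : `|t| <= N.+1%:R^-1 / (M * `|h| + 1).
  by near: t; exact: tsmall.
rewrite ler_pdivlMr//; apply: le_trans.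
by rewrite ler_wpM2l// lerDl.
Unshelve. all: by end_near. Qed.

Lemma truncated_sup_gateaux0 : gateaux_differentiable (f : X -> R^o) 0.
Proof.
exists (\0 : {linear X -> R^o}); first by move=> x; exact: cvg_cst.
move=> h; apply/is_derive_quotientP => e e0; near=> t.
have t0 : t != 0 by near: t; exact: nbhs_dnbhs_neq.
rewrite /= addr0 truncated_sup0 subr0 sub0r normrN normrM normfV.
rewrite ler_pdivrMl ?normr_gt0// mulrC ger0_norm ?truncated_sup_ge0//.
by near: t; apply: nbhs_dnbhs; exact: truncated_sup_small.
Unshelve. all: by end_near. Qed.

(** The function is even, so adding the Frechet estimates at [y] and [- y]
    eliminates the derivative without computing it. *)
Lemma truncated_sup_uniform (Y : normedModType R) (T : {linear Y -> X}) (e : R) :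
  differentiable ((f : X -> R^o) \o T) 0 -> 0 < e ->
  \forall n \near \oo, forall y : Y, `|y| <= 1 -> `|p n (T y)| <= e.
Proof.
move=> dfT e0; have e20 : 0 < e / 2 by rewrite divr_gt0.
have /nbhs_norm0P[d /= d0 dP] := differentiable_norm_le dfT e20.
have fTle y : `|y| < d -> f (T y) <= e / 2 * `|y|.
  move=> yd.
  have := dP y yd; have := dP (- y); rewrite /= normrN => /(_ yd).
  rewrite !addr0 linear0 truncated_sup0 !subr0 [T (- y)]linearN truncated_supN.
  set D := 'd _ _.
  have -> : D (- y) = - D y :> R by rewrite /D linearN.
  move=> /(le_trans (ler_norm _)) + /(le_trans (ler_norm _)); lra.
have d20 : 0 < d / 2 by rewrite divr_gt0.
have de : 0 < d / 2 * (e / 2) by rewrite mulr_gt0.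
(* The Frechet estimate is used at [d / 2 *: y], which lies in the ball of radius [d]. *)
near=> n => y y1.
have dyE : `|d / 2 *: y| = d / 2 * `|y| by rewrite normrZ gtr0_norm.
have dy : `|d / 2 *: y| <= d / 2 by rewrite dyE ger_pMr.
have fdy := fTle (d / 2 *: y) ltac:(lra).
have := truncated_sup_ge (T (d / 2 *: y)) n.
have -> : p n (T (d / 2 *: y)) = d / 2 * p n (T y) :> R by rewrite !linearZ.
rewrite normrM (gtr0_norm d20) => pn.
have nd : n.+1%:R^-1 < d / 2 * (e / 2).
  by near: n; exact: (near_infty_natSinv_lt (PosNum de)).
have fd : f (T (d / 2 *: y)) <= d / 2 * (e / 2).
  by rewrite (le_trans fdy)// mulrC ler_wpM2r// ltW.
rewrite -(ler_pM2l d20) [in leRHS](splitr e) mulrDr.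
by apply: le_trans (lerD fd (ltW nd)); rewrite -lerBlDr.
Unshelve. all: by end_near. Qed.

End truncated_sup.

Theorem theorem1 (R : realType) (Y X : completeNormedModType R)
    (T : {linear Y -> X}) (T_cont : continuous T) :
  limited_operator T <->
  (forall f : X -> R^o,
     convex_function [set: convex_lmodType X] f -> continuous f ->
     forall y : Y, gateaux_differentiable f (T y) ->
       differentiable (f \o T) y).
Proof.
split=> [LT f /convex_functionP cf ctf y|H].
  exact: limited_frechet.
apply/limited_operatorP => p p0 e e0.
apply: truncated_sup_uniform => //; apply: H.
- exact/convex_functionP/truncated_sup_convex.
- exact: truncated_sup_continuous.
- by rewrite linear0; exact: truncated_sup_gateaux0.
Qed.
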